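(* The integrality gap of the linear programming relaxation described in the context is at least $3$; that is, for every $\rho<3$ there is an instance $I$ of the capacitated tree cover problem with edge loads with $\mathrm{OPT}(I)>\rho\cdot\mathrm{OPT}_{LP}(I)$.
   Context: Capacitated tree cover problem with edge loads: given a complete graph $G=(V,E)$, metric edge costs $c:E\to\mathbb{R}_+$, vertex loads $b:V\to[0,1)$, metric edge loads $u:E\to\mathbb{R}_{\ge0}$ with $u(e)<u(f)\Rightarrow c(e)\le c(f)$, and $\gamma\ge0$, find $k\ge1$ and a spanning forest $F$ of $G$ with $k$ trees $T_1,\dots,T_k$, each with $\sum_{e\in E(T_i)}u(e)+\sum_{v\in V(T_i)}b(v)\le1$, minimizing $\sum_{e\in E(F)}c(e)+\gamma k$; $\mathrm{OPT}(I)$ is the optimum value. LP relaxation: minimize $\sum_{e\in E}c(e)x(e)+\gamma(|V|-x(E))$ subject to $x(E(G[A]))\le|A|-1$ for all $A\subseteq V$, $\sum_{e\in E(G[A])}(1+u(e))x(e)\le|A|-b(A)$ for all $A\subseteq V$, and $0\le x(e)\le 1$ for all $e\in E$, where $E(G[A])$ is the set of edges with both endpoints in $A$, $x(F)=\sum_{e\in F}x(e)$ and $b(A)=\sum_{v\in A}b(v)$; $\mathrm{OPT}_{LP}(I)$ is its optimum value. The integrality gap is $\sup_I \mathrm{OPT}(I)/\mathrm{OPT}_{LP}(I)$. *)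

(* Defs.v *)
From mathcomp Require Import all_boot all_order all_algebra.
From mathcomp Require Import boolp classical_sets reals ereal.

Set Implicit Arguments.
Unset Strict Implicit.
Unset Printing Implicit Defensive.

Import Order.TTheory GRing.Theory Num.Theory.
Local Open Scope ring_scope.

(* An edge of the complete graph on [V] is a two-element set of vertices.
   Functions on edges are functions on [{set V}]; their values at sets that are
   not edges are never used. *)
Definition edges (V : finType) : {set {set V}} :=
  [set e : {set V} | #|e| == 2%N]%SET.

Definition edges_in (V : finType) (A : {set V}) : {set {set V}} :=
  [set e in edges V | e \subset A]%SET.

(* The triangle inequality is only asked of genuine edges, hence the
   distinctness conditions. *)
Definition metric_edges (R : realType) (V : finType) (d : {set V} -> R) : Prop :=
  (forall e, e \in edges V -> 0 <= d e) /\
  (forall x y z : V, x != y -> y != z -> x != z ->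
     d [set x; z]%SET <= d [set x; y]%SET + d [set y; z]%SET).

Record instance (R : realType) := Instance {
  vertex : finType;
  vertex_gt0 : (0 < #|vertex|)%N;
  cost : {set vertex} -> R;
  vload : vertex -> R;
  eload : {set vertex} -> R;
  gamma : R;
  cost_metric : metric_edges cost;
  vload_bounds : forall v, 0 <= vload v < 1;
  eload_metric : metric_edges eload;
  eload_cost : forall e f, e \in edges vertex -> f \in edges vertex ->
    eload e < eload f -> cost e <= cost f;
  gamma_ge0 : 0 <= gamma }.

Definition adj (V : finType) (F : {set {set V}}) : rel V :=
  fun x y => [set x; y]%SET \in F.

(* [ucycle] allows the sequences [:: x; y] running back and forth along one
   edge, so a cycle of the graph is one of size at least 3. *)
Definition is_forest (V : finType) (F : {set {set V}}) : Prop :=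
  F \subset edges V /\ (forall s : seq V, ucycle (adj F) s -> (size s <= 2)%N).

(* Vertex sets of the connected components of the graph (V, F). *)
Definition components (V : finType) (F : {set {set V}}) : {set {set V}} :=
  equivalence_partition (connect (adj F)) [set: V]%SET.

(* The trees of a spanning forest are its connected components, and there is at
   least one since [vertex I] is nonempty. *)
Definition feasible_forest (R : realType) (I : instance R)
    (F : {set {set vertex I}}) : Prop :=
  is_forest F /\
  (forall T, T \in components F ->
     \sum_(e in F | e \subset T) eload e + \sum_(v in T) vload v <= 1).

Definition forest_value (R : realType) (I : instance R)
    (F : {set {set vertex I}}) : R :=
  \sum_(e in F) cost e + gamma I * #|components F|%:R.

(* The set of values is finite, nonempty (take F empty) and bounded below by 0,
   so the infimum is a minimum. *)
Definition OPT (R : realType) (I : instance R) : R :=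
  inf [set v | exists2 F, feasible_forest F & v = forest_value (I := I) F]%classic.

(* The constraints range over nonempty A: the first one would read 0 <= -1 for
   A empty. *)
Definition feasible_LP (R : realType) (I : instance R)
    (x : {set vertex I} -> R) : Prop :=
  [/\ forall A : {set vertex I}, A != finset.set0 ->
        \sum_(e in edges_in A) x e <= #|A|%:R - 1,
      forall A : {set vertex I}, A != finset.set0 ->
        \sum_(e in edges_in A) (1 + eload e) * x e
          <= #|A|%:R - \sum_(v in A) vload v
    & forall e, e \in edges (vertex I) -> 0 <= x e <= 1].

Definition LP_value (R : realType) (I : instance R)
    (x : {set vertex I} -> R) : R :=
  \sum_(e in edges (vertex I)) cost e * x e
    + gamma I * (#|vertex I|%:R - \sum_(e in edges (vertex I)) x e).

(* The feasible region is a nonempty polytope (it contains x = 0), so the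
   infimum is a minimum; it is nonnegative. *)
Definition OPT_LP (R : realType) (I : instance R) : R :=
  inf [set v | exists2 x, feasible_LP x & v = LP_value (I := I) x]%classic.

(* OPT_LP I = 0 only if gamma I = 0, and then OPT I = 0 as well; these
   instances, whose ratio is 0 / 0, are left out. *)
Definition integrality_gap (R : realType) : \bar R :=
  ereal_sup [set r | exists2 I : instance R,
    0 < OPT_LP I & r = (OPT I / OPT_LP I)%:E]%classic.

(* Main.v *)
(* Take a hub joined to n leaves by spokes of load s slightly above 1/2, all
   other edges having load 2s, with zero costs and vertex loads and gamma = 1.
   No tree may contain two spokes or a leaf-leaf edge, so a feasible forest has
   at most one edge and thus at least n components. Fractionally, giving each
   spoke the value 1/(1+s), close to 2/3, is feasible and costs
   n + 1 - n/(1+s), about n/3. *)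

Require Import Defs.
From mathcomp Require Import all_boot all_order all_algebra.
From mathcomp Require Import boolp classical_sets reals ereal.
From mathcomp Require Import ring lra.

Import Order.TTheory GRing.Theory Num.Theory.
Local Open Scope ring_scope.

(** * Edges at a vertex and connected components *)

Lemma edges_in_setT (V : finType) : edges_in [set: V]%SET = edges V.
Proof. by apply/setP => e; rewrite inE finset.subsetT andbT. Qed.

(** The map [v] to [{h, v}] is a bijection from the other vertices of [A] onto these edges. *)
Lemma card_edges_in_at (V : finType) (h : V) (A : {set V}) : h \in A ->
  #|[set e in edges_in A | h \in e]%SET| = #|A|.-1.
Proof.
move=> hA.
have -> : [set e in edges_in A | h \in e]%SET
    = [set [set h; v]%SET | v in (A :\ h)%SET]%SET.
  apply/setP => e; apply/idP/imsetP.
    rewrite !inE => /andP[/andP[/cards2P[x [y [xy ->]]]]].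
    rewrite finset.subUset !finset.sub1set => /andP[xA yA].
    rewrite !inE => /orP[] /eqP hE.
      by exists y; rewrite hE // !inE eq_sym xy.
    exists x; rewrite hE; last exact: finset.setUC.
    by rewrite !inE xy.
  move=> [v]; rewrite !inE => /andP[vh vA] ->.
  by rewrite cards2 (eq_sym h) vh finset.subUset !finset.sub1set hA vA !inE eqxx.
rewrite card_in_imset; first by rewrite (cardsD1 h A) hA.
move=> v w; rewrite !inE => /andP[vh _] /andP[wh _] /setP/(_ v).
by rewrite !inE eqxx orbT (negPf vh) /= => /esym/eqP.
Qed.

Lemma pblock_componentsE (V : finType) (F : {set {set V}}) (x y : V) :
  (y \in finset.pblock (components F) x) = connect (adj F) x y.
Proof.
have sym : connect_sym (adj F).
  by apply: sym_connect_sym => u v; rewrite /adj finset.setUC.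
apply: (@pblock_equivalence_partition V (connect (adj F)) [set: V]%SET) => //;
  rewrite ?inE // => u v w _ _ _.
by split; [exact: connect0 | move=> uv; exact: (same_connect sym uv)].
Qed.

Lemma pblock_components_mem (V : finType) (F : {set {set V}}) (x : V) :
  finset.pblock (components F) x \in components F.
Proof.
apply: pblock_mem.
have : x \in finset.pblock (components F) x.
  by rewrite pblock_componentsE connect0.
rewrite /finset.pblock; case: pickP => [B /andP[BF xB] _ | _]; last by rewrite inE.
by apply/bigcupP; exists B.
Qed.

(** Since [f] is constant along edges, it is constant on components, so vertices of [B] with
    distinct images lie in distinct components. This bounds the number of trees from below without
    counting edges. *)
Lemma leq_card_components (V W : finType) (F : {set {set V}}) (f : V -> W)
    (B : {set V}) :
  (forall x y, adj F x y -> f x = f y) -> {in B &, injective f} ->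
  (#|B| <= #|components F|)%N.
Proof.
move=> fadj finj.
have fconn x y : connect (adj F) x y -> f x = f y.
  move=> /connectP[p]; elim: p x => [x _ -> //|z p IH x /= /andP[xz zp] yE].
  by rewrite (fadj _ _ xz) (IH z).
rewrite -(@card_in_imset _ _ (finset.pblock (components F)) B).
  apply/subset_leq_card/fintype.subsetP => _ /imsetP[x _ ->].
  exact: pblock_components_mem.
move=> x y xB yB E; apply: finj => //; apply: fconn.
by rewrite -pblock_componentsE E pblock_componentsE connect0.
Qed.

(** * The star instance and its integral optimum *)

Definition star_load (R : realType) (V : finType) (h : V) (s : R)
    (e : {set V}) : R := if h \in e then s else 2 * s.

(** Two loads always add up to at least [s + s], which is the largest load of a single edge. *)
Lemma star_load_metric (R : realType) (V : finType) (h : V) (s : R) :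
  0 <= s -> metric_edges (star_load R V h s).
Proof.
move=> s0; rewrite /star_load; split => [e _|x y z _ _ _].
  by case: ifP => _ //; lra.
by do 3 case: ifP => _; lra.
Qed.

Lemma zero_metric (R : realType) (V : finType) :
  metric_edges (fun _ : {set V} => 0 : R).
Proof. by split => // *; rewrite addr0. Qed.

Definition star_instance (R : realType) (V : finType) (h : V) (s : R)
    (s0 : 0 <= s) : instance R :=
  @Instance R V (introT card_gt0P (ex_intro _ h isT))
    (fun=> 0) (fun=> 0) (star_load R V h s) 1
    (zero_metric R V) (fun=> introT andP (conj (lexx 0) ltr01))
    (star_load_metric R V h s s0) (fun _ _ _ _ _ => lexx 0) ler01.

(** The capacity leaves at most one edge, a spoke. Contracting it gives a map that is constant along
    edges and injective off the hub, so the leaves witness [#|V|.-1] components. *)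
Lemma star_components (R : realType) (V : finType) (h : V) (s : R)
    (s0 : 0 <= s) (F : {set {set V}}) : 1 < 2 * s ->
  feasible_forest (I := star_instance R V h s s0) F ->
  (#|V|.-1 <= #|components F|)%N.
Proof.
move=> s1 [[/fintype.subsetP Fedge _] /= load].
have load_comp x : \sum_(e in F | e \subset finset.pblock (components F) x)
    star_load R V h s e <= 1.
  have := load _ (pblock_components_mem V F x).
  by rewrite [X in _ + X]big1_eq addr0.
have load_ge0 e : 0 <= star_load R V h s e by rewrite /star_load; case: ifP; lra.
have sub_comp x y : adj F x y ->
    [set x; y]%SET \subset finset.pblock (components F) x.
  move=> xy; rewrite finset.subUset !finset.sub1set !pblock_componentsE connect0.
  exact: connect1.
have hub x y : adj F x y -> h \in [set x; y]%SET.
  move=> xy; apply/negPn/negP => hxy.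
  (* An edge avoiding the hub has load [2 * s > 1] and overloads its component alone. *)
  have := load_comp x; rewrite (bigD1 [set x; y]%SET) /=; last first.
    by rewrite sub_comp // andbT.
  rewrite {1}/star_load (negPf hxy) => le1.
  have : 0 <= \sum_(i | (i \in F) && (i \subset finset.pblock (components F) x)
    && (i != [set x; y]%SET)) star_load R V h s i by apply: sumr_ge0.
  lra.
have uniq_spoke x y : adj F h x -> adj F h y -> x = y.
  move=> hx hy; apply/eqP/negPn/negP => xy.
  have xh : x != h.
    by have := Fedge _ hx; rewrite inE cards2 (eq_sym h); case: (x == h).
  have yh : y != h.
    by have := Fedge _ hy; rewrite inE cards2 (eq_sym h); case: (y == h).
  have exy : [set h; y]%SET != [set h; x]%SET.
    apply/eqP => /setP/(_ y).
    by rewrite !inE eqxx orbT (negPf yh) eq_sym (negPf xy).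
  (* Two distinct spokes both lie in the component of [h] and together have load [s + s > 1]. *)
  have := load_comp h; rewrite (bigD1 [set h; x]%SET) /=; last first.
    by rewrite sub_comp // andbT.
  rewrite (bigD1 [set h; y]%SET) /=; last by rewrite sub_comp // exy !andbT.
  rewrite {1 2}/star_load !inE eqxx /=.
  set S := (X in s + (s + X)).
  have : 0 <= S by apply: sumr_ge0.
  lra.
(* The leaf of the only spoke, or [h] itself if there is no spoke; the hub will be sent to it. *)
pose i0 := odflt h [pick v | adj F h v].
have i0P v : adj F h v -> i0 = v.
  rewrite /i0; case: pickP => [w hw /= hv|no hv]; first exact: uniq_spoke.
  by rewrite no in hv.
have adjC x y : adj F x y = adj F y x by rewrite /adj finset.setUC.
have adjh : adj F h h = false.
  by apply/negP => /Fedge; rewrite inE cards2 eqxx.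
have -> : #|V|.-1 = #|[set~ h]%SET| by rewrite cardsC1.
apply: (leq_card_components _ _ _ (fun v => if v == h then i0 else v)).
  move=> x y xy; have := hub _ _ xy; rewrite !inE => /orP[] /eqP hE;
    subst h; rewrite eqxx.
    by case: eqP xy => [->|_ /i0P //]; rewrite adjh.
  by case: eqP xy => [->|_]; rewrite ?adjh // adjC => /i0P.
by move=> x y; rewrite !inE => /negPf-> /negPf->.
Qed.

(** This makes the set of forest values nonempty, as needed to bound its infimum from below. *)
Lemma feasible_forest0 (R : realType) (V : finType) (h : V) (s : R)
    (s0 : 0 <= s) :
  feasible_forest (I := star_instance R V h s s0) finset.set0.
Proof.
split=> [|T _ /=].
  split=> [|[|x [|y p]] //]; first exact: finset.sub0set.
  by rewrite /ucycle /= /adj inE => /andP[].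
rewrite [X in _ + X]big1_eq addr0 big_pred0 => [|e]; first exact: ler01.
by rewrite inE.
Qed.

Lemma star_OPT_ge (R : realType) (V : finType) (h : V) (s : R)
    (s0 : 0 <= s) : 1 < 2 * s ->
  #|V|.-1%:R <= OPT (star_instance R V h s s0).
Proof.
move=> s1; apply: lb_le_inf.
  by eexists; exists finset.set0; first exact: feasible_forest0.
move=> _ [F Ffeas ->]; rewrite /forest_value /= big1_eq add0r mul1r ler_nat.
exact: (star_components _ _ _ _ _ _ s1 Ffeas).
Qed.

(** * The linear relaxation on the star *)

Lemma sum_edges_in_at (R : realType) (V : finType) (h : V) (A : {set V})
    (a : R) : A != finset.set0 ->
  \sum_(e in edges_in A) (if h \in e then a else 0)
    = if h \in A then (#|A|%:R - 1) * a else 0.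
Proof.
move=> A0; rewrite -big_mkcondr /=; case: ifP => hA.
  rewrite -(@natrB _ _ 1) ?card_gt0 // subn1 -(card_edges_in_at _ h) //.
  rewrite mulr_natl -sumr_const; apply: eq_bigl => e.
  by rewrite [RHS]inE.
apply: big_pred0 => e; apply/negP; rewrite !inE => /andP[/andP[_ /fintype.subsetP eA]].
by move=> /eA; rewrite hA.
Qed.

Definition star_LP_solution (R : realType) (V : finType) (h : V) (s : R)
    (e : {set V}) : R := if h \in e then (1 + s)^-1 else 0.

Lemma star_LP_feasible (R : realType) (V : finType) (h : V) (s : R)
    (s0 : 0 <= s) :
  feasible_LP (I := star_instance R V h s s0) (star_LP_solution R V h s).
Proof.
have inv_ge0 : 0 <= (1 + s)^-1 by rewrite invr_ge0; lra.
have inv_le1 : (1 + s)^-1 <= 1 by rewrite invf_le1; lra.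
have card1 (A : {set V}) : A != finset.set0 -> 1 <= #|A|%:R :> R.
  by move=> A0; rewrite (ler_nat _ 1) card_gt0.
split=> [A A0|A A0|e _] /=.
- rewrite sum_edges_in_at //; have := card1 A A0; case: ifP => _ A1; last lra.
  by rewrite ler_piMr //; lra.
- rewrite big1_eq subr0.
  (* Each spoke contributes [(1 + s) / (1 + s) = 1], so the sum is at most [#|A| - 1], one below the
     bound. *)
  rewrite (eq_bigr (fun e : {set V} => if h \in e then 1 else 0)).
    by rewrite sum_edges_in_at //; have := card1 A A0; case: ifP => _; lra.
  move=> e _; rewrite /star_LP_solution /star_load.
  by case: ifP => _; rewrite ?mulr0 // divff //; lra.
- by rewrite /star_LP_solution; case: ifP; rewrite ?inv_ge0 ?lexx ?ler01.
Qed.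

(** The first constraint for the whole vertex set leaves at least one fractional component. This
    gives both the lower bound that the infimum needs and a positive denominator for the ratio. *)
Lemma star_LP_value_ge1 (R : realType) (V : finType) (h : V) (s : R)
    (s0 : 0 <= s) (x : {set V} -> R) :
  feasible_LP (I := star_instance R V h s s0) x ->
  1 <= LP_value (I := star_instance R V h s s0) x.
Proof.
move=> [/(_ [set: V]%SET) xV _ _]; rewrite /LP_value /=.
rewrite big1 => [|e _]; last exact: mul0r.
have : [set: V]%SET != finset.set0 by rewrite -card_gt0 cardsT; apply/card_gt0P; exists h.
by move=> /xV; rewrite edges_in_setT cardsT /=; lra.
Qed.

Lemma star_OPT_LP_ge1 (R : realType) (V : finType) (h : V) (s : R)
    (s0 : 0 <= s) : 1 <= OPT_LP (star_instance R V h s s0).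
Proof.
apply: lb_le_inf.
  by eexists; exists (star_LP_solution R V h s); first exact: star_LP_feasible.
by move=> _ [x xfeas ->]; exact: star_LP_value_ge1.
Qed.

Lemma star_OPT_LP_le (R : realType) (V : finType) (h : V) (s : R)
    (s0 : 0 <= s) :
  OPT_LP (star_instance R V h s s0) <= #|V|%:R - (#|V|%:R - 1) / (1 + s).
Proof.
apply: ge_inf.
  by exists 1 => _ [x xfeas ->]; exact: star_LP_value_ge1.
exists (star_LP_solution R V h s); first exact: star_LP_feasible.
rewrite /LP_value /= big1 => [|e _]; last exact: mul0r.
have V0 : [set: V]%SET != finset.set0.
  by rewrite -card_gt0 cardsT; apply/card_gt0P; exists h.
by rewrite -edges_in_setT sum_edges_in_at // inE cardsT add0r mul1r.
Qed.

(** * Choice of parameters and the gap *)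

Lemma exists_gap_instance (R : realType) (rho : R) : rho < 3 ->
  exists I : instance R, 0 < OPT_LP I /\ OPT I > rho * OPT_LP I.
Proof.
move=> rho3.
(* The final inequality amounts to [13 * n + 6 < (3 - rho) * (n * n + 5 * n + 2)]; as [n >= 1], the
   left side is at most [19 * n]. *)
pose n := (Num.bound (19 / (3 - rho))).+1.
have n1 : 1 <= n%:R :> R by rewrite (ler_nat _ 1).
have n_large : 19 < n%:R * (3 - rho).
  rewrite -ltr_pdivrMr ?subr_gt0 //.
  apply: lt_trans (_ : (Num.bound (19 / (3 - rho)))%:R < _).
    by apply: archi_boundP; apply: divr_ge0; lra.
  by rewrite ltr_nat.
(* This exceeds 1/2 for every [n] and tends to 1/2 as [n] grows. *)
pose s : R := 2^-1 + n%:R^-1.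
have ninv : 0 < n%:R^-1 :> R by rewrite invr_gt0; lra.
have s0 : 0 <= s by rewrite /s; lra.
exists (star_instance R 'I_n.+1 ord0 s s0).
have LP1 := star_OPT_LP_ge1 R 'I_n.+1 ord0 s s0.
split; first lra.
have := star_OPT_ge R 'I_n.+1 ord0 s s0; rewrite card_ord /= => OPTn.
apply: lt_le_trans (OPTn _); last by rewrite /s; lra.
(* The upper bound on [OPT_LP] may be multiplied by [rho] only if [rho] is positive; otherwise the
   left side is at most 0. *)
have [rho0|rho0] := lerP rho 0.
  by apply: le_lt_trans (_ : 0 < _); [rewrite mulr_le0_ge0 //; lra | lra].
have := star_OPT_LP_le R 'I_n.+1 ord0 s s0.
rewrite card_ord -natr1 addrK -(ler_pM2l rho0) => /le_lt_trans; apply.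
set N : R := n%:R in n1 n_large ninv s s0 LP1 OPTn *.
have -> : N + 1 - N / (1 + s) = (N * N + 5 * N + 2) / (3 * N + 2).
  by rewrite /s; field; rewrite -/N !lt0r_neq0 //; lra.
rewrite mulrA ltr_pdivrMr; last lra.
(* These two products supply the nonlinear terms, after which the goal is linear in the
   monomials. *)
have : 19 * N < N * (3 - rho) * N by rewrite ltr_pM2r //; lra.
have : 0 <= (3 - rho) * (5 * N + 2) by apply: mulr_ge0; lra.
lra.
Qed.

Theorem theorem9 (R : realType) :
  (3%:E <= integrality_gap R)%E /\
  (forall rho : R, rho < 3 -> exists I : instance R, OPT I > rho * OPT_LP I).
Proof.
split; last by move=> rho /exists_gap_instance[I [_ gapI]]; exists I.
(* The supremum need not be attained, so the bound is shown up to every [e > 0], with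
   [rho = 3 - e]. *)
apply/lee_addgt0Pr => e e0.
have /exists_gap_instance[I [LP0 gapI]] : 3 - e < 3 :> R by lra.
rewrite -leeBlDr // -EFinB.
apply: le_trans (_ : (OPT I / OPT_LP I)%:E <= _)%E.
  by rewrite lee_fin ler_pdivlMr // ltW.
by apply: ereal_sup_ubound; exists I.
Qed.
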